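(* Let $A$ be an alphabet with $|A| = 2$, let $n$ be a positive integer and $k \ge 2$ an integer. If $w = u\diamond^k v$ is a universal partial word for $A^n$, where $u$ and $v$ are nonempty words over $A$ (containing no $\diamond$), then $|u| \le n-1$ and $|v| \le n-1$.
   Context: A partial word over $A$ is a finite sequence of characters from $A \cup \{\diamond\}$, where $\diamond \notin A$ is a wild-card symbol; a word over $A$ contains no $\diamond$. $A^n$ denotes the set of words of length $n$ over $A$. For $x = x_1\cdots x_n \in A^n$ and a partial word $w = w_1\cdots w_N$, the position $i$ ($0 \le i \le N-n$) covers $x$ if $x_j = w_{i+j}$ for every $1\le j\le n$ with $w_{i+j}\in A$. A universal partial word for $A^n$ is a partial word $w$ such that every word in $A^n$ is covered by exactly one position of $w$. $\diamond^k$ denotes $k$ consecutive $\diamond$'s. *)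

(* Defs.v *)
From mathcomp Require Import all_boot.

Set Implicit Arguments.
Unset Strict Implicit.
Unset Printing Implicit Defensive.

(* The wild card is [None]; a letter a of the alphabet is [Some a]. *)
Definition partial_word (A : Type) := seq (option A).

Definition of_word (A : Type) (u : seq A) : partial_word A := map Some u.

Definition wildcards (A : Type) (k : nat) : partial_word A := nseq k None.

(* Letters are numbered from 0. The first conjunct, i <= N - n, keeps every
   index i + j in range, so the default value of [nth] is never used. *)
Definition covers (A : Type) (n : nat) (w : partial_word A) (i : nat)
    (x : n.-tuple A) : Prop :=
  i + n <= size w /\
  forall (j : 'I_n) (a : A), nth None w (i + j) = Some a -> tnth x j = a.

Definition universal_partial_word (A : Type) (n : nat) (w : partial_word A) :
    Prop :=
  forall x : n.-tuple A, exists! i : nat, covers w i x.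

(* Main.v *)
Require Import Defs.
From mathcomp Require Import all_boot zify.

(** Suppose [u] is long, and let [q] be the position whose window is [c y ◇],
    with [c] a letter and [◇] the first wild card; the next window is [y ◇ ◇].
    Every word [b y a] with [b <> c] is covered somewhere. Were it covered
    before the last position, then the following position and [q + 1] would
    both cover some word extending [y a] to the right, so that [b y a] would be
    covered at [q], contradicting [b <> c]. Hence the last position covers
    [b y a] for every letter [a], although [w] ends with a letter. The bound on
    [v] follows by reversal. *)

Section PartialWords.

Set Implicit Arguments.
Unset Strict Implicit.

Variable A : eqType.
Implicit Types (w : partial_word A) (u v : seq A) (n i : nat) (f : nat -> A).

Lemma covers_mktuple n w i f :
  covers w i [tuple f j | j < n] <->
  i + n <= size w /\
  forall j, j < n -> forall a, nth None w (i + j) = Some a -> f j = a.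
Proof.
split=> -[hi h]; split=> //.
  by move=> j hj a /(h (Ordinal hj)); rewrite tnth_mktuple.
by move=> j a; rewrite tnth_mktuple; apply: h.
Qed.

Lemma universal_covers n w f :
  universal_partial_word n w -> exists i, covers w i [tuple f j | j < n].
Proof. by move=> /(_ [tuple f j | j < n])[i [hi _]]; exists i. Qed.

Lemma universal_inj n w (x : n.-tuple A) i i' :
  universal_partial_word n w -> covers w i x -> covers w i' x -> i = i'.
Proof. by move=> /(_ x)[p [_ hp]] /hp <- /hp <-. Qed.

(** Read from the right end, the window starting at [i] starts at [size w - n - i]; the bound
    [i + n <= size w] keeps the subtractions exact. *)
Lemma covers_rev n w i (x : n.-tuple A) :
  covers w i x -> covers (rev w) (size w - n - i) [tuple of rev x].
Proof.
move=> [hi h]; split; first by rewrite size_rev; lia.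
move=> j a.
have hj := ltn_ord j.
have hj' : n - j.+1 < n by lia.
rewrite nth_rev; last by lia.
have -> : size w - (size w - n - i + j).+1 = i + Ordinal hj' by rewrite /=; lia.
move=> /h <-; rewrite !(tnth_nth a) /= nth_rev ?size_tuple //.
Qed.

Lemma universal_rev n w :
  universal_partial_word n w -> universal_partial_word n (rev w).
Proof.
move=> hw x; have [i [hi _]] := hw [tuple of rev x].
have revxK : [tuple of rev [tuple of rev x]] = x.
  by apply: val_inj; rewrite /= revK.
exists (size w - n - i); split.
  by have := covers_rev hi; rewrite revxK.
(* Uniqueness: reflecting [i'] back gives a position of [w] covering [rev x], and the reflection is
   injective on valid positions. *)
move=> i' hi'; have := covers_rev hi'; rewrite revK => hr.
have := universal_inj hw hi hr.
by case: hi hi' => [hi _] [hi' _]; move: hi'; rewrite size_rev; lia.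
Qed.

Lemma rev_two_words u v k :
  rev (of_word u ++ wildcards A k ++ of_word v) =
  of_word (rev v) ++ wildcards A k ++ of_word (rev u).
Proof.
rewrite !rev_cat -!map_rev -catA; congr (_ ++ (_ ++ _)).
by apply: (@eq_from_nth _ None); rewrite size_rev // => i hi;
  rewrite nth_rev ?size_rev // !nth_nseq !if_same.
Qed.

Lemma universal_two_wildcards n w q (b c d : A) :
    universal_partial_word n w -> 0 < n -> b != c ->
    q + n < size w -> nth None w q = Some c ->
    nth None w (q + n.-1) = None -> nth None w (q + n) = None ->
  nth None w (size w).-1 = Some d -> forall a, a = d.
Proof.
move=> hw n0 hbc hq hc h1 h2 hd a.
(* For [n = 1] the positions [q] and [q + n.-1] coincide, yet one holds a letter and the other a
   wild card. *)
have n1 : 1 < n.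
  by case: n n0 h1 {hw hq h2} => [|[|n]] //= _; rewrite addn0 hc.
(* The word [b y a]; any wild card inside [y] is filled with [d], an arbitrary choice. *)
pose f (j : nat) := if j == 0 then b else
                    if j == n.-1 then a else odflt d (nth None w (q + j)).
have [p hp] := universal_covers f hw.
have [hpn hpf] := (covers_mktuple n w p f).1 hp.
case: (ltnP (p + n) (size w)) => hpw; last first.
  have hl : p + n.-1 = (size w).-1 by lia.
  have hn1 : n.-1 < n by lia.
  have := hpf _ hn1 d; rewrite hl => /(_ hd).
  by rewrite /f eqxx; case: eqP => //; lia.
(* The word [y a s], where [s] is chosen to match [w] just after the window of [p]. *)
pose g j := if j < n.-1 then f j.+1 else odflt d (nth None w (p + n)).
have hgp : covers w p.+1 [tuple g j | j < n].
  apply/covers_mktuple; split; first by lia.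
  move=> j hj e; rewrite /g; case: ltnP => hj1.
    by rewrite addSnnS; apply: hpf; lia.
  have -> : p.+1 + j = p + n by lia.
  by case: nth => [s [<-]|].
have hgq : covers w q.+1 [tuple g j | j < n].
  apply/covers_mktuple; split; first by lia.
  move=> j hj e; rewrite /g; case: ltnP => hj1; last first.
    have -> : q.+1 + j = q + n by lia.
    by rewrite h2.
  (* The letter [a] falls on the first wild card, and [y] was copied from [w]. *)
  rewrite addSnnS /f /=; case: eqP => [->|_ ->] //.
  by rewrite h1.
have [epq] := universal_inj hw hgp hgq.
have := hpf 0 n0 c; rewrite epq addn0 => /(_ hc) ebc.
by move: hbc; rewrite (ebc : b = c) eqxx.
Qed.

Lemma universal_prefix_short n k u v (b b' : A) :
    b != b' -> 0 < n -> 1 < k -> v <> [::] ->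
    universal_partial_word n (of_word u ++ wildcards A k ++ of_word v) ->
  size u <= n - 1.
Proof.
move=> hbb n0 k1 hv; set w := _ ++ _ => hw.
have sw : size w = size u + (k + size v).
  by rewrite !size_cat !size_map size_nseq.
have sv : 0 < size v by case: (v) hv.
have wu i : i < size u -> nth None w i = Some (nth b u i).
  by move=> hi; rewrite nth_cat size_map hi (nth_map b).
have wk i : size u <= i < size u + k -> nth None w i = None.
  move=> /andP[hi1 hi2]; rewrite nth_cat size_map ltnNge hi1 /=.
  by rewrite nth_cat size_nseq ltn_subLR // hi2 nth_nseq if_same.
have wv : nth None w (size w).-1 = Some (nth b v (size v).-1).
  rewrite nth_cat size_map ltnNge (_ : size u <= _) /=; last by lia.
  rewrite nth_cat size_nseq ltnNge (_ : k <= _) /=; last by lia.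
  rewrite (nth_map b); last by lia.
  by congr (Some (nth _ _ _)); lia.
rewrite leqNgt; apply/negP => hun.
(* For [n = 1] no window holds both a letter and a wild card, but two adjacent wild cards already
   cover the same word twice. *)
case: (leqP n 1) => n1.
  have en : n = 1 by lia.
  have cov i : size u <= i < size u + k -> covers w i [tuple b | _ < n].
    move=> hi; apply/(covers_mktuple n w i (fun=> b)); split; first by lia.
    by move=> j hj a; rewrite wk //; lia.
  have := universal_inj hw (cov (size u) _) (cov (size u).+1 _); lia.
(* The window of [q] ends exactly on the first wild card, at index [size u]; as [1 < n <= size u],
   it starts inside [u]. *)
pose q := size u - n + 1.
pose c := nth b u q.
pose e := if b == c then b' else b.
have hec : e != c.
  by rewrite /e; case: (eqVneq b c) => [<-|//]; rewrite eq_sym.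
have key := universal_two_wildcards hw n0 hec (q := q) (d := nth b v (size v).-1).
have {}key : forall a, a = nth b v (size v).-1.
  by apply: key => //; [lia | apply: wu; lia | apply: wk; lia | apply: wk; lia].
by move: hbb; rewrite (key b) (key b') eqxx.
Qed.

End PartialWords.

Theorem theorem3p2 (A : finType) (hA : #|A| = 2) (n k : nat)
    (hn : 0 < n) (hk : 2 <= k) (u v : seq A)
    (hu : u <> [::]) (hv : v <> [::])
    (hw : universal_partial_word n (of_word u ++ wildcards A k ++ of_word v)) :
  size u <= n - 1 /\ size v <= n - 1.
Proof.
have /card_gt1P[b [b' [_ _ hbb]]] : 1 < #|A| by rewrite hA.
split; first exact: universal_prefix_short hbb hn hk hv hw.
rewrite -size_rev; apply: (universal_prefix_short (v := rev u) hbb hn hk).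
  by move=> /(congr1 rev); rewrite revK.
by rewrite -rev_two_words; apply: universal_rev.
Qed.
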